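(* Let $\{\eta(u),\mathbf{q}(u)\}$ be an entropy pair and $v(u)=\eta'(u)$ the corresponding entropy variable. Define $v_h=\sum_{j=1}^{N_h}v_j\varphi_j$ using the Bernstein coefficients $v_j=v(u_j)$, $j=1,\ldots,N_h$. Let $u_h=\sum_{j=1}^{N_h}u_j\varphi_j$ be determined by the flux-corrected semi-discrete scheme $$\sum_{e\in\mathcal{E}_i}m_{i}^e\frac{\mathrm{d}u_i}{\mathrm{d}t}=\sum_{e\in\mathcal E_i}\sum_{j\in\tilde{\mathcal N}_i^e\setminus\{i\}}\left[\tilde d_{ij}^e(u_j-u_i)+\bar f_{ij}^{e}-\tilde{\mathbf{c}}_{ij}^e\cdot(\mathbf{f}(u_j)-\mathbf{f}(u_i))\right],\qquad i=1,\ldots,N_h.$$ Suppose that the limited subcell fluxes $\bar f_{ij}^e$ satisfy, for all $e=1,\ldots,E_h$, $i\in\mathcal N^e$, $j\in\tilde{\mathcal N}_i^e\setminus\{i\}$, $$\frac{v_i-v_j}{2}\left[\tilde d_{ij}^e(u_j-u_i)+\bar f_{ij}^e-\tilde{\mathbf{c}}_{ij}^e\cdot(\mathbf{f}(u_j)+\mathbf{f}(u_i))\right]-\tilde{\mathbf{c}}_{ij}^e\cdot[\boldsymbol{\psi}(u_j)-\boldsymbol{\psi}(u_i)]\le \tilde p_{ij}^e,$$ where $\boldsymbol{\psi}(u)=v(u)\mathbf{f}(u)-\mathbf{q}(u)$ and the real numbers $\tilde p_{ij}^e$ satisfy, for all $e=1,\ldots,E_h$, $$\sum_{i\in\mathcal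 N^e}\sum_{j\in\tilde{\mathcal N}^e_i\setminus\{i\}}\tilde p_{ij}^e\le\sum_{i\in\mathcal N^e}\sum_{j\in\mathcal N^e\setminus\{i\}}(\tilde{\mathbf{c}}_{ij}^e-\mathbf{c}_{ij}^e)\cdot\left[\left(\frac{v_i-v_j}{2}\right)(\mathbf{f}(u_j)-\mathbf{f}(u_i))+\mathbf{q}(u_j)-\mathbf{q}(u_i)\right].$$ Then the discrete entropy inequality $$\sum_{e=1}^{E_h}\sum_{i\in\mathcal N^e}m_{i}^e\frac{\mathrm{d}\eta(u_i)}{\mathrm{d}t}\le\sum_{e=1}^{E_h}\sum_{i\in\mathcal N^e}\sum_{j\in\mathcal N^e\setminus\{i\}}\left[G_{ij}^e-\mathbf{c}_{ij}^e\cdot(\mathbf{q}(u_j)-\mathbf{q}(u_i))\right]$$ holds, where $$G_{ij}^e=\frac{v_i+v_j}{2}\left[\tilde d_{ij}^e(u_j-u_i)+\bar f_{ij}^e\right]-\frac{v_i-v_j}{2}\,\mathbf{c}_{ij}^e\cdot(\mathbf{f}(u_j)-\mathbf{f}(u_i)),$$ with $\bar f_{ij}^e:=0$ for $j\in\mathcal N^e\setminus(\tilde{\mathcal N}_i^e\cup\{i\})$.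
   Context: The scalar conservation law is $\frac{\partial u}{\partial t}+\nabla\cdot\mathbf{f}(u)=0$ in $\mathbb{R}^d\times\mathbb{R}_+$, $d\in\{1,2,3\}$, with a possibly nonlinear, differentiable flux function $\mathbf{f}$. Let $\mathcal G\subset\mathbb{R}$ be a convex set (an invariant set of the initial value problem). A convex (differentiable) function $\eta:\mathcal G\to\mathbb{R}$ is called an entropy, and $v(u)=\eta'(u)$ the entropy variable, if there is an entropy flux $\mathbf{q}:\mathcal G\to\mathbb{R}^d$ with $v(u)\mathbf{f}'(u)=\mathbf{q}'(u)$; $\{\eta,\mathbf{q}\}$ is then an entropy pair. The values $u_i$ lie in $\mathcal G$. Discretization: $\mathcal T_h=\{K^1,\ldots,K^{E_h}\}$ is a conforming mesh of a bounded domain in $\mathbb{R}^d$, with $\bar\Omega_h=\bigcup_{e=1}^{E_h}K^e$; periodic boundary conditions are assumed. For $p\in\mathbb{N}$, $V_h^e\in\{\mathbb{P}_p(K^e),\mathbb{Q}_p(K^e)\}$ and $V_h=\{v_h\in C(\bar\Omega_h): v_h|_{K^e}\in V_h^e,\ e=1,\ldots,E_h\}$. The functions $\varphi_1,\ldots,\varphi_{N_h}$ are the Bernstein basis functions of $V_h$ (nonnegative, forming a partition of unity), associated with nodal points $\mathbf{x}_1,\ldots,\mathbf{x}_{N_h}$; the time-dependent, differentiable coefficients $u_j$ in $u_h=\sum_j u_j\varphi_j$ are called Bernstein coefficients. $\mathcal E_i$ is the set of indices of elements containing $\mathbf{x}_i$, and $\mathcal N^e$ is the set of indices of nodes belonging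 to $K^e$. Element matrices, with indices in $\mathcal N^e$: $m_{ij}^e=\int_{K^e}\varphi_i\varphi_j\,\mathrm{d}\mathbf{x}$, $M_C^e=(m_{ij}^e)$; $m_i^e=\sum_{j\in\mathcal N^e}m_{ij}^e=\int_{K^e}\varphi_i\,\mathrm{d}\mathbf{x}>0$, $M_L^e=(\delta_{ij}m_i^e)$; $\mathbf{c}_{ij}^e=\int_{K^e}\varphi_i\nabla\varphi_j\,\mathrm{d}\mathbf{x}\in\mathbb{R}^d$, $\mathbf{C}^e=(\mathbf{c}_{ij}^e)$; and $\tilde{\mathbf{C}}^e=(\tilde{\mathbf{c}}_{ij}^e)=M_L^e(M_C^e)^{-1}\mathbf{C}^e$ (applied to each of the $d$ components). The compact element stencil of node $i\in\mathcal N^e$ is $\tilde{\mathcal N}_i^e=\{j\in\mathcal N^e: |\tilde{\mathbf{c}}_{ij}^e|+|\tilde{\mathbf{c}}_{ji}^e|>0\}$. The artificial diffusion coefficients are, by default, given by the local Lax-Friedrichs formula $\tilde d_{ij}^e=\max\{|\tilde{\mathbf{c}}_{ij}^e|\lambda_{ij}^{\max},|\tilde{\mathbf{c}}_{ji}^e|\lambda_{ji}^{\max}\}$ for $i\in\mathcal N^e$, $j\in\tilde{\mathcal N}_i^e\setminus\{i\}$, $\tilde d_{ii}^e=-\sum_{k\in\tilde{\mathcal N}_i^e\setminus\{i\}}\tilde d_{ik}^e$, and $\tilde d_{ij}^e=0$ otherwise. Here $\lambda_{ij}^{\max}$ is an upper bound for the maximal wave speed, $\lambda_{ij}^{\max}\ge\max_{\omega\in[0,1]}|\mathbf{n}_{ij}^e\cdot\mathbf{f}'(\omega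 u_i+(1-\omega)u_j)|$ with $\mathbf{n}_{ij}^e=\tilde{\mathbf{c}}_{ij}^e/|\tilde{\mathbf{c}}_{ij}^e|$ (a term with $\tilde{\mathbf{c}}_{ij}^e=\mathbf{0}$ contributes $0$). The $\bar f_{ij}^e$ are real-valued (possibly solution-dependent) subcell fluxes defined for $i\in\mathcal N^e$, $j\in\tilde{\mathcal N}_i^e\setminus\{i\}$. *)

(* Defs.v *)
From HB Require Import structures.
From mathcomp Require Import all_boot all_order all_algebra.
From mathcomp Require Import all_classical all_reals all_analysis.
Set Implicit Arguments.
Unset Strict Implicit.
Unset Printing Implicit Defensive.
Import Order.TTheory GRing.Theory Num.Theory.
Import numFieldNormedType.Exports.
Local Open Scope classical_set_scope.
Local Open Scope ring_scope.

Section Euclidean.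
Variables (R : realType) (d : nat).

Definition dot (x y : 'rV[R]_d) : R := \sum_(k < d) x 0 k * y 0 k.

(* The library norm of ['rV_d] is the maximum norm. *)
Definition enorm (x : 'rV[R]_d) : R := Num.sqrt (dot x x).

Definition gradient (g : 'rV[R]_d -> R) (x : 'rV[R]_d) : 'rV[R]_d :=
  \row_(k < d) 'D_(delta_mx 0 k) g x.

End Euclidean.

(* Lebesgue integral over R^d, as an iterated one-dimensional one (Fubini). *)
Fixpoint space_integral (R : realType) (d : nat) : ('rV[R]_d -> R) -> R :=
  match d return ('rV[R]_d -> R) -> R with
  | 0 => fun g => g 0
  | d'.+1 => fun g =>
      \int[@lebesgue_measure R]_s
        space_integral (fun y : 'rV[R]_d' => g (row_mx (const_mx s : 'rV_1) y))
  end.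

Definition integral_on (R : realType) (d : nat) (D : set 'rV[R]_d)
    (g : 'rV[R]_d -> R) : R :=
  space_integral (fun x => \1_D x * g x).

Section RelativeDerivative.
Variables (R : realType) (G : set R).

(* Derivative of a function whose domain is the convex set [G]: one-sided at an
   end point of [G] that belongs to [G], two-sided in the interior. *)
Definition derivable_in (V : normedModType R) (g : R -> V) (a : R) : Prop :=
  cvg ((fun y => (y - a)^-1 *: (g y - g a)) @ within G a^').

Definition derive_in (V : normedModType R) (g : R -> V) (a : R) : V :=
  lim ((fun y => (y - a)^-1 *: (g y - g a)) @ within G a^').

End RelativeDerivative.

Section Entropy.
Variables (R : realType) (d : nat) (G : set R) (f : R -> 'rV[R]_d).

Record entropy_pair (eta : R -> R) (q : R -> 'rV[R]_d) : Prop := {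
  entropy_convex : convex_function (G : set R^o) eta ;
  entropy_derivable : forall u, G u -> derivable_in G eta u ;
  entropy_flux_derivable : forall u, G u -> derivable_in G q u ;
  entropy_flux_compatible : forall u, G u ->
    derive_in G eta u *: derive_in G f u = derive_in G q u }.

Definition entropy_variable (eta : R -> R) : R -> R := derive_in G eta.

Definition entropy_potential (eta : R -> R) (q : R -> 'rV[R]_d) (u : R)
    : 'rV[R]_d :=
  entropy_variable eta u *: f u - q u.

End Entropy.

Section Mesh.
Variables (R : realType) (d : nat).
Local Notation point := 'rV[R]_d.

(* A simplex, or the image of the unit cube under a multilinear map (interval,
   quadrilateral, hexahedron), given by its vertices. *)
Inductive element :=
  | Simplex of ('I_d.+1 -> point)
  | Cuboid of ({ffun 'I_d -> bool} -> point).

Definition ref_cell (K : element) : set point :=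
  match K with
  | Simplex _ => [set xi | (forall k, 0 <= xi 0 k) /\ \sum_k xi 0 k <= 1]
  | Cuboid _ => [set xi | forall k, 0 <= xi 0 k <= 1]
  end.

Definition ref_map (K : element) (xi : point) : point :=
  match K with
  | Simplex a =>
      (1 - \sum_k xi 0 k) *: a ord0 + \sum_k xi 0 k *: a (lift ord0 k)
  | Cuboid a =>
      \sum_(b : {ffun 'I_d -> bool}) (\prod_k (if b k then xi 0 k else 1 - xi 0 k)) *: a b
  end.

Definition cell (K : element) : set point := ref_map K @` ref_cell K.

Definition nondegenerate (K : element) : Prop :=
  {in ref_cell K &, injective (ref_map K)} /\
  (forall xi, ref_cell K xi -> \det ('J (ref_map K) xi) != 0).

Definition translate (l : point) (K : element) : element :=
  match K with
  | Simplex a => Simplex (fun k => a k + l)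
  | Cuboid a => Cuboid (fun b => a b + l)
  end.

Definition barycentric (xi : point) (k : 'I_d.+1) : R :=
  if unlift ord0 k is Some k' then xi 0 k' else 1 - \sum_k' xi 0 k'.

(* Proper faces: [S] is the set of vertices of a face of a simplex; a face of
   the cube is obtained by fixing the coordinates [k] with [s k <> None]. *)
Definition proper_face (K : element) (F : set point) : Prop :=
  match K with
  | Simplex _ => exists2 S : {set 'I_d.+1}, (0 < #|S| <= d)%N &
      F = ref_map K @` [set xi | ref_cell K xi /\
        forall k, k \notin S -> barycentric xi k = 0]
  | Cuboid _ => exists2 s : {ffun 'I_d -> option bool}, (exists k, s k != None) &
      F = ref_map K @` [set xi | ref_cell K xi /\
        forall k b, s k = Some b -> xi 0 k = b%:R]
  end.

(* The period lattice is spanned by the rows of [P]. *)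
Definition lattice (P : 'M[R]_d) : set point :=
  [set map_mx intr z *m P | z in [set: 'rV[int]_d]].

Definition same_mod (P : 'M[R]_d) (x y : point) : Prop := lattice P (y - x).

(* Periodic boundary conditions: the domain is a period cell, and the translates
   of the mesh by the period lattice form a conforming mesh of R^d, that is, the
   mesh is conforming after identification of opposite boundary points. *)
Record periodic_mesh (Omega : set point) (P : 'M[R]_d) (E : nat)
    (K : 'I_E -> element) : Prop := {
  domain_nonempty : Omega !=set0 ;
  domain_open : open Omega ;
  domain_connected : connected Omega ;
  domain_bounded : bounded_set Omega ;
  mesh_domain : closure Omega = \bigcup_(e in [set: 'I_E]) cell (K e) ;
  mesh_nondegenerate : forall e, nondegenerate (K e) ;
  mesh_periods : P \in unitmx ;
  mesh_period_cell : forall x, exists2 y, closure Omega y & same_mod P x y ;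
  mesh_conforming : forall e e' l, lattice P l -> (e, 0) <> (e', l) ->
    let I := cell (K e) `&` cell (translate l (K e')) in
    I = set0 \/ (proper_face (K e) I /\ proper_face (translate l (K e')) I) }.

End Mesh.

Section FiniteElements.
Variables (R : realType) (d : nat).
Local Notation point := 'rV[R]_d.
Variable p : nat.

Local Notation multiindex := {ffun 'I_d -> 'I_p.+1}.

(* Exponents of P_p on simplices and of Q_p on images of the cube. *)
Definition exponents (K : element R d) : {set multiindex} :=
  match K with
  | Simplex _ => finset (fun a : multiindex => (\sum_k a k <= p)%N)
  | Cuboid _ => finset (fun=> true)
  end.

Definition local_space (K : element R d) : set (point -> R) :=
  [set w | exists c : multiindex -> R, forall xi, ref_cell K xi ->
     w (ref_map K xi) =
       \sum_(a in exponents K) c a * \prod_k xi 0 k ^+ a k].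

(* For a simplex, [p - |a|] is the exponent of the remaining barycentric
   coordinate and the coefficient is multinomial. *)
Definition bernstein (K : element R d) (a : multiindex) (xi : point) : R :=
  match K with
  | Simplex _ =>
      let r := (p - \sum_k a k)%N in
      p`!%:R / (r`!%:R * \prod_k (a k)`!%:R) *
        ((1 - \sum_k xi 0 k) ^+ r * \prod_k xi 0 k ^+ a k)
  | Cuboid _ =>
      \prod_k ('C(p, a k)%:R * xi 0 k ^+ a k * (1 - xi 0 k) ^+ (p - a k))
  end.

Definition local_node (K : element R d) (a : multiindex) : point :=
  ref_map K (\row_k ((a k)%:R / p%:R)).

Variables (Omega : set point) (P : 'M[R]_d) (E : nat) (K : 'I_E -> element R d).

Definition fe_space : set (point -> R) :=
  [set w | [/\ {within closure Omega, continuous w},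
               (forall x y, closure Omega x -> closure Omega y ->
                  same_mod P x y -> w x = w y) &
               (forall e, local_space (K e) w)]].

(* The sum in [basis_local] has more than one term only if the element contains
   periodically identified nodes, and is empty if [x i] is not a node of it. *)
Record bernstein_basis (N : nat) (x : 'I_N -> point) (phi : 'I_N -> point -> R)
    : Prop := {
  nodes_local : forall i,
    exists e, exists2 a, a \in exponents (K e) & x i = local_node (K e) a ;
  nodes_all : forall e a, a \in exponents (K e) ->
    exists i, same_mod P (x i) (local_node (K e) a) ;
  nodes_distinct : forall i j, same_mod P (x i) (x j) -> i = j ;
  basis_space : forall i, fe_space (phi i) ;
  basis_local : forall i e xi, ref_cell (K e) xi ->
    phi i (ref_map (K e) xi) =
      \sum_(a in exponents (K e) | `[< same_mod P (x i) (local_node (K e) a) >])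
        bernstein (K e) a xi }.

End FiniteElements.

Section ElementMatrices.
Variables (R : realType) (d : nat).
Local Notation point := 'rV[R]_d.
Variables (P : 'M[R]_d) (E N : nat) (K : 'I_E -> element R d).
Variables (x : 'I_N -> point) (phi : 'I_N -> point -> R).

Definition node_in (i : 'I_N) (e : 'I_E) : bool :=
  `[< exists2 y, cell (K e) y & same_mod P (x i) y >].

Definition nodes_of (e : 'I_E) : {set 'I_N} := finset (fun i => node_in i e).

Definition elements_of (i : 'I_N) : {set 'I_E} := finset (fun e => node_in i e).

Definition mass (e : 'I_E) (i j : 'I_N) : R :=
  integral_on (cell (K e)) (fun y => phi i y * phi j y).

Definition lumped_mass (e : 'I_E) (i : 'I_N) : R :=
  \sum_(j in nodes_of e) mass e i j.

(* The gradient is classical in the interior of the cell; its values on the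
   boundary, where [phi j] need not be differentiable, are immaterial. *)
Definition grad_coef (e : 'I_E) (i j : 'I_N) : point :=
  \row_k integral_on (cell (K e)) (fun y => phi i y * gradient (phi j) y 0 k).

(* A family indexed by [A * A] as a matrix, and back (0 outside [A * A]). *)
Definition mx_on (A : {set 'I_N}) (a : 'I_N -> 'I_N -> R) : 'M[R]_#|A| :=
  \matrix_(r, s) a (enum_val r) (enum_val s).

Definition mx_entry (A : {set 'I_N}) (M : 'M[R]_#|A|) (i j : 'I_N) : R :=
  \sum_(r | enum_val r == i) \sum_(s | enum_val s == j) M r s.

Definition lumped_grad_coef (e : 'I_E) (i j : 'I_N) : point :=
  \row_k mx_entry
    (mx_on (nodes_of e) (fun i j => if i == j then lumped_mass e i else 0)
     *m invmx (mx_on (nodes_of e) (mass e))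
     *m mx_on (nodes_of e) (fun i j => grad_coef e i j 0 k)) i j.

Definition stencil (e : 'I_E) (i : 'I_N) : {set 'I_N} :=
  finset (fun j => (j \in nodes_of e) &&
    (0 < enorm (lumped_grad_coef e i j) + enorm (lumped_grad_coef e j i))).

Definition wave_speed_bound (f : R -> point) (G : set R) (e : 'I_E)
    (i j : 'I_N) (ui uj lambda : R) : Prop :=
  let c := lumped_grad_coef e i j in
  let n := (enorm c)^-1 *: c in
  c != 0 -> forall w, 0 <= w <= 1 ->
    `|dot n (derive_in G f (w * ui + (1 - w) * uj))| <= lambda.

(* Local Lax-Friedrichs coefficients for the wave speed bounds [lambda]. *)
Definition llf_diffusion (lambda : 'I_E -> 'I_N -> 'I_N -> R) (e : 'I_E)
    (i j : 'I_N) : R :=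
  let dt i j := Num.max (enorm (lumped_grad_coef e i j) * lambda e i j)
                        (enorm (lumped_grad_coef e j i) * lambda e j i) in
  if j == i then - \sum_(k in (stencil e i :\ i)%SET) dt i k
  else if j \in stencil e i then dt i j else 0.

End ElementMatrices.

(* Main.v *)
Require Import Defs.
From mathcomp Require Import all_boot all_order all_algebra.
From mathcomp Require Import all_classical all_reals all_analysis.
From mathcomp Require Import ring lra.
Import Order.TTheory GRing.Theory Num.Theory.
Import numFieldNormedType.Exports.
Local Open Scope classical_set_scope.
Local Open Scope ring_scope.

(** The scheme is tested with the entropy variables: the equation of node [i]
    is multiplied by [v_i] and the equations are summed over all nodes.

    On the left, the chain rule turns [v_i * u_i'] into the time derivative of
    [eta (u_i)] ([derive1_comp_in]).  On the right, the double sum over nodes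
    and the elements containing them is reordered into a sum over elements.
    With [g_ij = d_ij (u_j - u_i) + fbar_ij] and [ct_ij] the coefficients of the
    scheme, each term is then split by means of
    [v_i = (v_i + v_j) / 2 + (v_i - v_j) / 2]:
    - [(v_i + v_j) / 2 g_ij] is the diffusive and antidiffusive part of [G_ij];
    - [(v_i - v_j) / 2 (g_ij - ct_ij . (f_j + f_i))] is what the condition on
      the limited fluxes bounds by [p_ij + ct_ij . (psi_j - psi_i)].
    Once [psi = v f - q] is inserted, everything that multiplies [ct_ij]
    collapses to [- ((v_i - v_j) / 2 (f_j - f_i) + q_j - q_i)]
    ([entropy_production_le]).  Off the compact stencil [ct_ij] and [g_ij] vanish, so
    the sums extend to all pairs of nodes of the element ([sum_stencil]).  The
    assumption on the sum of the [p_ij] over an element is exactly what replaces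
    [ct_ij] by [c_ij] in this expression, and the outcome is the right-hand side
    of the claim. *)

Section DotProduct.
Context {R : realType} {d : nat}.
Implicit Types x y z : 'rV[R]_d.

Lemma dotDr x y z : dot x (y + z) = dot x y + dot x z.
Proof.
by rewrite /dot -big_split; apply: eq_bigr => k _; rewrite mxE mulrDr.
Qed.

Lemma dotZr x (a : R) y : dot x (a *: y) = a * dot x y.
Proof.
by rewrite /dot mulr_sumr; apply: eq_bigr => k _; rewrite mxE mulrCA.
Qed.

Lemma dotNr x y : dot x (- y) = - dot x y.
Proof. by rewrite -scaleN1r dotZr mulN1r. Qed.

Lemma dotC x y : dot x y = dot y x.
Proof. by apply: eq_bigr => k _; rewrite mulrC. Qed.

Lemma dotBl x y z : dot (x - y) z = dot x z - dot y z.
Proof. by rewrite dotC dotDr dotNr !(dotC z). Qed.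

Lemma dot0l x : dot 0 x = 0.
Proof. by rewrite dotC -(scale0r 0) dotZr mul0r. Qed.

Lemma enorm_ge0 x : 0 <= enorm x.
Proof. exact: sqrtr_ge0. Qed.

Lemma enorm_eq0 x : enorm x = 0 -> x = 0.
Proof.
have sq_ge0 k : 0 <= x 0 k * x 0 k by rewrite -expr2 sqr_ge0.
move/eqP; rewrite sqrtr_eq0 => xx_le0.
have /eqP : dot x x == 0 by rewrite eq_le xx_le0 sumr_ge0.
move/psumr_eq0P => /(_ (fun k _ => sq_ge0 k)) x0.
apply/rowP => k; rewrite mxE; apply/eqP.
by rewrite -[_ == _]orbb -mulf_eq0 x0.
Qed.

End DotProduct.

(** Chain rule for a curve [u] that stays in the domain [G] of [g].  The slope
    of [g] at [a = u t], completed by its limit at [a], gives the factorization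
    [g (u s) - g a = slope (u s) * (u s - a)], valid also where [u s = a].  Hence
    neither end points nor isolated points of [G] need a separate treatment:
    near an isolated point the limit is arbitrary, but [u] is constant there. *)
Lemma derive1_comp_in {R : realType} {G : set R} {V : normedModType R}
    {g : R -> V} {u : R -> R} {t : R} :
  derivable u t 1 -> (\forall s \near t, G (u s)) ->
  derivable_in G g (u t) ->
  (g \o u)^`()%classic t = u^`()%classic t *: derive_in G g (u t).
Proof.
move=> du Gu dg; set a := u t.
pose slope y := if y == a then derive_in G g a else (y - a)^-1 *: (g y - g a).
have slopeE y : g y - g a = (y - a) *: slope y.
  rewrite /slope; have [->|ya] := eqVneq y a; first by rewrite !subrr scale0r.
  by rewrite scalerA divff ?scale1r// subr_eq0.
have cvg_slope : slope y @[y --> within G (nbhs a)] --> derive_in G g a.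
  move=> A nA.
  have dA : \forall y \near a, y != a -> G y -> A ((y - a)^-1 *: (g y - g a)).
    exact: (dg A nA).
  change (\forall y \near a, G y -> A (slope y)).
  near=> y => Gy; rewrite /slope.
  have [_|ya] := eqVneq y a; first exact: nbhs_singleton.
  by apply: (near dA y) => //; near: y.
have cvg_u : u (h + t) @[h --> 0^'] --> a.
  have /differentiable_continuous cu : differentiable u t.
    exact/derivable1_diffP.
  apply: cvg_trans (_ : u (h + t) @[h --> (0:R)] --> a).
    by apply: cvg_app; exact: nbhs_dnbhs.
  apply: (@cvg_comp _ _ _ (fun h => h + t) u _ (nbhs t)) => //.
  have : h + t @[h --> (0:R)] --> 0 + t.
    by apply: cvgD; [exact: cvg_id|exact: cvg_cst].
  by rewrite add0r.
have near_G : \forall h \near (0:R)^', G (u (h + t)).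
  apply: nbhs_dnbhs.
  by move: Gu; rewrite (near_shift 0); apply: filterS => h /=; rewrite subr0.
apply: cvg_lim => //.
have -> : (fun h => h^-1 *: ((g \o u) (h + t) - (g \o u) t)) =
          (fun h => (h^-1 *: (u (h + t) - u t)) *: slope (u (h + t))).
  by apply/funext => h /=; rewrite slopeE scalerA.
apply: cvgZ.
  rewrite derive1E; move: du; rewrite /derivable /derive /=.
  have -> : (fun h => h^-1 *: (u (h *: 1 + t) - u t)) =
            (fun h => h^-1 *: (u (h + t) - u t)) :> (R -> R).
    by apply/funext => h; rewrite [h *: 1]mulr1.
  by [].
apply: cvg_comp cvg_slope => A GA.
by apply: filterS2 near_G (cvg_u _ GA) => h Gh; apply.
Unshelve. all: by end_near. Qed.

Lemma near_time_interval {R : realType} (T : \bar R) (t : R) :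
  0 < t -> (t%:E < T)%E -> \forall s \near t, 0 < s /\ (s%:E < T)%E.
Proof.
move=> t0 tT; near=> s; split.
  by near: s; exact: lt_nbhsr.
near: s; case: T tT => [r| |] //.
  by rewrite lte_fin => tr; near=> s; rewrite lte_fin; near: s; exact: lt_nbhsl.
by move=> _; near=> s; rewrite ltry.
Unshelve. all: by end_near. Qed.

(** The entropy production of one pair of nodes, with [c] for [ct_ij] and [g]
    for the artificial diffusion plus the subcell flux.  The hypothesis is
    Tadmor's condition with the potential [v f - q] written out; the
    conclusion has the same difference of sides, because
    [(v_i - v_j) / 2 (f_j + f_i) - v_i (f_j - f_i) + v_j f_j - v_i f_i
     = - (v_i - v_j) / 2 (f_j - f_i)]. *)
Lemma entropy_production_le {R : realType} {d : nat} {c : 'rV[R]_d}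
    {vi vj g p : R} {fi fj qi qj : 'rV[R]_d} :
  (vi - vj) / 2 * (g - dot c (fj + fi))
    - dot c ((vj *: fj - qj) - (vi *: fi - qi)) <= p ->
  vi * (g - dot c (fj - fi)) <=
    (vi + vj) / 2 * g + p
    - dot c (((vi - vj) / 2) *: (fj - fi) + qj - qi).
Proof.
rewrite !(dotDr, dotNr, dotZr) => le_p.
lra.
Qed.

Section Stencil.
Context {R : realType} {d E N : nat}.
Variables (P : 'M[R]_d) (K : 'I_E -> element R d).
Variables (x : 'I_N -> 'rV[R]_d) (phi : 'I_N -> 'rV[R]_d -> R).

Lemma stencil_sub e i : stencil P K x phi e i \subset nodes_of P K x e.
Proof. by apply/fintype.subsetP => j; rewrite inE => /andP[]. Qed.

Lemma lumped_grad_coef_notin_stencil e i j :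
  j \in nodes_of P K x e -> j \notin stencil P K x phi e i ->
  lumped_grad_coef P K x phi e i j = 0.
Proof.
move=> je; rewrite inE je /= -leNgt => n_le0; apply: enorm_eq0; apply/eqP.
rewrite eq_le enorm_ge0 andbT; apply: le_trans n_le0.
by rewrite lerDl enorm_ge0.
Qed.

Lemma sum_elements_of (F : 'I_N -> 'I_E -> R) :
  \sum_i \sum_(e in elements_of P K x i) F i e =
  \sum_e \sum_(i in nodes_of P K x e) F i e.
Proof.
rewrite (exchange_big_dep xpredT)//=; apply: eq_bigr => e _.
by apply: eq_bigl => i; rewrite !inE.
Qed.

(** The scheme sums over compact stencils, whereas the bound on the production
    terms and the entropy inequality sum over whole elements: [c_ij], unlike
    [ct_ij], need not vanish off the stencil. *)
Lemma sum_stencil e i (F : 'I_N -> R) :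
  (forall j, j \in (nodes_of P K x e :\ i)%SET ->
    j \notin stencil P K x phi e i -> F j = 0) ->
  \sum_(j in (stencil P K x phi e i :\ i)%SET) F j =
  \sum_(j in (nodes_of P K x e :\ i)%SET) F j.
Proof.
move=> F0; rewrite [RHS](bigID (fun j => j \in stencil P K x phi e i))/= [X in _ + X]big1 ?addr0.
  apply: eq_bigl => j; rewrite !in_setD1 -andbA; congr andb.
  by rewrite andb_idl//; exact: (fintype.subsetP (stencil_sub e i)).
by move=> j /andP[]; exact: F0.
Qed.

End Stencil.

Theorem theorem3 (R : realType) (d : nat) (hd : (1 <= d <= 3)%N)
  (* flux and entropy pair *)
  (G : set R) (hG : convex_set (G : set R^o))
  (f : R -> 'rV[R]_d) (hf : forall u, G u -> derivable_in G f u)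
  (eta : R -> R) (q : R -> 'rV[R]_d) (hpair : entropy_pair G f eta q)
  (* mesh and Bernstein basis *)
  (E N p : nat) (hp : (0 < p)%N)
  (Omega : set 'rV[R]_d) (P : 'M[R]_d) (K : 'I_E -> element R d)
  (hmesh : periodic_mesh Omega P K)
  (x : 'I_N -> 'rV[R]_d) (phi : 'I_N -> 'rV[R]_d -> R)
  (hphi : bernstein_basis p Omega P K x phi)
  (* time interval and Bernstein coefficients *)
  (T : \bar R) (u : 'I_N -> R -> R)
  (hu : forall j (t : R), 0 < t -> (t%:E < T)%E -> derivable (u j) t 1)
  (huG : forall j (t : R), 0 < t -> (t%:E < T)%E -> G (u j t))
  (* wave speed bounds, subcell fluxes and entropy production bounds *)
  (lambda fbar ptilde : R -> 'I_E -> 'I_N -> 'I_N -> R) :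
  let Ne := nodes_of P K x in
  let Ei := elements_of P K x in
  let m := lumped_mass P K x phi in
  let c := grad_coef K phi in
  let ct := lumped_grad_coef P K x phi in
  let Nt := stencil P K x phi in
  let dt t := llf_diffusion P K x phi (lambda t) in
  let v j t := entropy_variable G eta (u j t) in
  let psi := entropy_potential G f eta q in
  forall
  (hlambda : forall (t : R) e i j, 0 < t -> (t%:E < T)%E ->
    i \in Ne e -> j \in Ne e -> i != j ->
    wave_speed_bound P K x phi f G e i j (u i t) (u j t) (lambda t e i j))
  (hscheme : forall (t : R) i, 0 < t -> (t%:E < T)%E ->
    (\sum_(e in Ei i) m e i) * (u i)^`()%classic t =
    \sum_(e in Ei i) \sum_(j in (Nt e i :\ i)%SET)
      (dt t e i j * (u j t - u i t) + fbar t e i j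
       - dot (ct e i j) (f (u j t) - f (u i t))))
  (hfbar : forall (t : R) e i j, 0 < t -> (t%:E < T)%E ->
    i \in Ne e -> j \in (Nt e i :\ i)%SET ->
    (v i t - v j t) / 2 *
      (dt t e i j * (u j t - u i t) + fbar t e i j
       - dot (ct e i j) (f (u j t) + f (u i t)))
    - dot (ct e i j) (psi (u j t) - psi (u i t))
    <= ptilde t e i j)
  (hptilde : forall (t : R) e, 0 < t -> (t%:E < T)%E ->
    \sum_(i in Ne e) \sum_(j in (Nt e i :\ i)%SET) ptilde t e i j
    <= \sum_(i in Ne e) \sum_(j in (Ne e :\ i)%SET)
         dot (ct e i j - c e i j)
             (((v i t - v j t) / 2) *: (f (u j t) - f (u i t))
              + q (u j t) - q (u i t))),
  let fbar0 (t : R) e i j := if j \in (Nt e i :\ i)%SET then fbar t e i j else 0 in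
  let Gij (t : R) e i j :=
    (v i t + v j t) / 2 * (dt t e i j * (u j t - u i t) + fbar0 t e i j)
    - (v i t - v j t) / 2 * dot (c e i j) (f (u j t) - f (u i t)) in
  forall t : R, 0 < t -> (t%:E < T)%E ->
    \sum_(e < E) \sum_(i in Ne e) m e i * (fun s => eta (u i s))^`()%classic t
    <= \sum_(e < E) \sum_(i in Ne e) \sum_(j in (Ne e :\ i)%SET)
         (Gij t e i j - dot (c e i j) (q (u j t) - q (u i t))).
Proof.
move=> Ne Ei m c ct Nt dt v psi hlambda hscheme hfbar hptilde fbar0 Gij t t0 tT.
pose g e i j := dt t e i j * (u j t - u i t) + fbar0 t e i j.
have deta i : (fun s => eta (u i s))^`()%classic t = (u i)^`()%classic t * v i t.
  apply: (derive1_comp_in (hu i t t0 tT)).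
    by apply: filterS (near_time_interval T t t0 tT) => s [s0 sT]; exact: huG.
  by apply: entropy_derivable hpair _ _; exact: huG.
have ct_off e i j : j \in Ne e -> j \notin Nt e i -> ct e i j = 0.
  exact: lumped_grad_coef_notin_stencil.
have g_off e i j : j != i -> j \notin Nt e i -> g e i j = 0.
  move=> ji js; rewrite /g /fbar0 in_setD1 ji (negPf js) /dt /llf_diffusion.
  by rewrite (negPf ji) -/(Nt e i) (negPf js) mul0r addr0.
(* The scheme, multiplied by [v_i] and summed over the nodes. *)
have -> : \sum_(e < E) \sum_(i in Ne e) m e i * (fun s => eta (u i s))^`()%classic t
  = \sum_(e < E) \sum_(i in Ne e) \sum_(j in (Nt e i :\ i)%SET)
      v i t * (g e i j - dot (ct e i j) (f (u j t) - f (u i t))).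
  rewrite -!sum_elements_of; apply: eq_bigr => i _.
  under eq_bigr do rewrite deta mulrA.
  rewrite -mulr_suml -mulr_suml hscheme// mulr_suml; apply: eq_bigr => e _.
  rewrite mulr_suml; apply: eq_bigr => j js.
  by rewrite /g /fbar0 js mulrC.
apply: ler_sum => e _.
apply: (@le_trans _ _ (\sum_(i in Ne e) \sum_(j in (Nt e i :\ i)%SET)
  (ptilde t e i j + ((v i t + v j t) / 2 * g e i j
   - dot (ct e i j) (((v i t - v j t) / 2) *: (f (u j t) - f (u i t))
                      + q (u j t) - q (u i t)))))).
  apply: ler_sum => i ie; apply: ler_sum => j js.
  have := hfbar t e i j t0 tT ie js; rewrite /psi /entropy_potential.
  have -> : dt t e i j * (u j t - u i t) + fbar t e i j = g e i j.
    by rewrite /g /fbar0 js.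
  by move/entropy_production_le; rewrite addrCA addrA.
under eq_bigr do rewrite big_split/=.
rewrite big_split/=; apply: le_trans (lerD (hptilde t e t0 tT) (lexx _)) _.
(* After the bound on the [ptilde], both sides agree node by node. *)
rewrite -big_split/= le_eqVlt; apply/orP; left; apply/eqP.
apply: eq_bigr => i ie; rewrite sum_stencil; last first.
  move=> j; rewrite in_setD1 => /andP[ji je] js.
  by rewrite ct_off// g_off// dot0l mulr0 subr0.
rewrite -big_split; apply: eq_bigr => j js /=.
rewrite /Gij -/(g e i j) dotBl !(dotDr, dotNr, dotZr).
ring.
Qed.
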